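(* In the $\mathcal M$-adhesive category $\mathbf{Graphs}$ (with $\mathcal M$ the injective graph morphisms), there is in general no finite set of finite transformation pairs that is complete with respect to parallel dependence: there exist finite rules $\rho_1=\langle p_1,ac_{L_1}\rangle$ and $\rho_2=\langle p_2,ac_{L_2}\rangle$ such that no finite set $\mathcal S$ of transformation pairs via $\rho_1,\rho_2$ between finite graphs is complete with respect to parallel dependence.
   Context: Application conditions (ACs) over a graph $P$: for every graph morphism $a\colon P\to C$ and AC $ac_C$ over $C$, $\exists(a,ac_C)$ is an AC over $P$; negations and finite conjunctions of ACs over $P$ are ACs over $P$ (the empty conjunction is $\mathrm{true}$). A morphism $p\colon P\to G$ satisfies $\exists(a,ac_C)$ if there is an injective $q\colon C\to G$ with $q\circ a=p$ and $q\models ac_C$; $\neg$ and $\wedge$ are interpreted as usual. A rule $\rho=\langle p,ac_L\rangle$ consists of a span $p=(L\leftarrow I\rightarrow R)$ of injective graph morphisms and an AC $ac_L$ over $L$; it is finite if $L,I,R$ and all graphs occurring in $ac_L$ are finite. A direct transformation $G\Rightarrow_{\rho,m}H$ is a double pushout diagram for $p$ with match $m\colon L\to G$ (intermediate graph $D$, $k\colon D\to G$, $c\colon D\to H$) such that $m\models ac_L$. A pair $H_1\Leftarrow_{\rho_1,m_1}G\Rightarrow_{\rho_2,m_2}H_2$ (with $k_i\colon D_i\to G$, $c_i\colon D_i\to H_i$) is parallel independent if there exist $d_{12}\colon L_1\to D_2$ with $k_2\circ d_{12}=m_1$ and $c_2\circ d_{12}\models ac_{L_1}$, and $d_{21}\colon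 L_2\to D_1$ with $k_1\circ d_{21}=m_2$ and $c_1\circ d_{21}\models ac_{L_2}$; otherwise it is parallel dependent. A pair $P_1\Leftarrow_{\rho_1,o_1}K\Rightarrow_{\rho_2,o_2}P_2$ can be embedded into $H_1\Leftarrow_{\rho_1,m_1}G\Rightarrow_{\rho_2,m_2}H_2$ via extension morphism $m\colon K\to G$ if $m_j=m\circ o_j$ and for each $j$ there are morphisms between intermediate and result graphs making all squares between the two double pushout diagrams commute and be pushouts. A set $\mathcal S$ of transformation pairs via $\rho_1,\rho_2$ is complete w.r.t. parallel dependence if for every parallel dependent pair $H_1\Leftarrow_{\rho_1,m_1}G\Rightarrow_{\rho_2,m_2}H_2$ there is a pair in $\mathcal S$ that can be embedded into it via some extension morphism. *)

(* Defs.v *)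
From mathcomp Require Import all_boot.
From mathcomp Require Import boolp classical_sets functions cardinality.

Set Implicit Arguments.
Unset Strict Implicit.
Unset Printing Implicit Defensive.

(* Directed multigraphs; parallel edges and loops are allowed, and neither    *)
(* the vertex type nor the edge type is required to be finite.                *)
Record graph : Type := Graph {
  vertex : Type;
  edge : Type;
  src : edge -> vertex;
  tgt : edge -> vertex
}.

Record hom (G H : graph) : Type := Hom {
  vmap : vertex G -> vertex H;
  emap : edge G -> edge H;
  hom_src : forall e, src (emap e) = vmap (src e);
  hom_tgt : forall e, tgt (emap e) = vmap (tgt e)
}.

Definition hom_comp (A B C : graph) (g : hom B C) (f : hom A B) : hom A C :=
  {| vmap := fun v => vmap g (vmap f v);
     emap := fun e => emap g (emap f e);
     hom_src := fun e =>
       etrans (hom_src g (emap f e)) (congr1 (vmap g) (hom_src f e));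
     hom_tgt := fun e =>
       etrans (hom_tgt g (emap f e)) (congr1 (vmap g) (hom_tgt f e)) |}.

Notation "g \oh f" := (hom_comp g f) (at level 40, left associativity).

Definition mono (G H : graph) (f : hom G H) : Prop :=
  injective (vmap f) /\ injective (emap f).

Definition finite_graph (G : graph) : Prop :=
  finite_set [set: vertex G] /\ finite_set [set: edge G].

(* The square   A --f--> B                                                    *)
(*              |g       |f'                                                  *)
(*              C --g'-> D    is a pushout in the category of all graphs.     *)
Definition is_pushout (A B C D : graph)
    (f : hom A B) (g : hom A C) (f' : hom B D) (g' : hom C D) : Prop :=
  f' \oh f = g' \oh g /\
  forall (X : graph) (h : hom B X) (k : hom C X), h \oh f = k \oh g ->
    exists! u : hom D X, u \oh f' = h /\ u \oh g' = k.

(* Application conditions over P; ac_and [::] is the condition true. The      *)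
(* morphism a need not be injective.                                          *)
Inductive ac (P : graph) : Type :=
| ac_ex (C : graph) (a : hom P C) (acC : ac C)
| ac_not (c : ac P)
| ac_and (cs : seq (ac P)).

Fixpoint sat (P : graph) (c : ac P) (G : graph) (p : hom P G) : Prop :=
  match c with
  | ac_ex C a acC =>
      exists q : hom C G, [/\ mono q, q \oh a = p & sat acC q]
  | ac_not c' => ~ sat c' p
  | ac_and cs =>
      (fix sat_all (cs : seq (ac P)) : Prop :=
         if cs is c' :: cs' then sat c' p /\ sat_all cs' else True) cs
  end.

Fixpoint finite_ac (P : graph) (c : ac P) : Prop :=
  finite_graph P /\
  match c with
  | ac_ex C a acC => finite_ac acC
  | ac_not c' => finite_ac c'
  | ac_and cs =>
      (fix finite_all (cs : seq (ac P)) : Prop :=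
         if cs is c' :: cs' then finite_ac c' /\ finite_all cs' else True) cs
  end.

Record span : Type := Span {
  lhs : graph;
  itf : graph;
  rhs : graph;
  lmor : hom itf lhs;
  rmor : hom itf rhs;
  lmor_mono : mono lmor;
  rmor_mono : mono rmor
}.

Record rule : Type := Rule {
  plain :> span;
  acL : ac (lhs plain)
}.

Definition finite_rule (rho : rule) : Prop :=
  [/\ finite_graph (lhs rho), finite_graph (itf rho), finite_graph (rhs rho)
    & finite_ac (acL rho)].

(* A direct transformation G => H via rho, i.e. a double pushout              *)
(*    L <--lmor-- I --rmor--> R                                               *)
(*    |match_     |imor       |comatch                                        *)
(*    G <--kmor-- D --cmor--> H                                               *)
(* whose match, not necessarily injective, satisfies the condition of rho.    *)
Record dtrans (rho : rule) (G H : graph) : Type := DTrans {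
  inter : graph;
  match_ : hom (lhs rho) G;
  imor : hom (itf rho) inter;
  comatch : hom (rhs rho) H;
  kmor : hom inter G;
  cmor : hom inter H;
  dpo_left : is_pushout (lmor rho) imor match_ kmor;
  dpo_right : is_pushout (rmor rho) imor comatch cmor;
  match_sat : sat (acL rho) match_
}.

Record tpair (rho1 rho2 : rule) : Type := TPair {
  source : graph;
  result1 : graph;
  result2 : graph;
  trans1 : dtrans rho1 source result1;
  trans2 : dtrans rho2 source result2
}.

Definition finite_tpair (rho1 rho2 : rule) (t : tpair rho1 rho2) : Prop :=
  [/\ finite_graph (source t), finite_graph (result1 t)
    & finite_graph (result2 t)].

(* One half of parallel independence: the match of t survives t' and still    *)
(* satisfies its application condition after t'.                              *)
Definition preserved (rho rho' : rule) (G H H' : graph)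
    (t : dtrans rho G H) (t' : dtrans rho' G H') : Prop :=
  exists d : hom (lhs rho) (inter t'),
    kmor t' \oh d = match_ t /\ sat (acL rho) (cmor t' \oh d).

Definition parallel_independent (rho1 rho2 : rule) (t : tpair rho1 rho2) :
    Prop :=
  preserved (trans1 t) (trans2 t) /\ preserved (trans2 t) (trans1 t).

Definition parallel_dependent (rho1 rho2 : rule) (t : tpair rho1 rho2) : Prop :=
  ~ parallel_independent t.

(* s : K => P is extended to t : G => H along m : K -> G. The squares between *)
(* the bottom rows of the two diagrams are pushouts; their top rows are the   *)
(* same span, so that the remaining squares have an identity on one side and  *)
(* are only asked to commute.                                                 *)
Definition extends (rho : rule) (K P G H : graph) (m : hom K G)
    (s : dtrans rho K P) (t : dtrans rho G H) : Prop :=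
  match_ t = m \oh match_ s /\
  exists (d : hom (inter s) (inter t)) (h : hom P H),
    [/\ imor t = d \oh imor s, comatch t = h \oh comatch s,
        is_pushout (kmor s) d m (kmor t)
      & is_pushout (cmor s) d h (cmor t)].

Definition embeds (rho1 rho2 : rule) (s t : tpair rho1 rho2) : Prop :=
  exists m : hom (source s) (source t),
    extends m (trans1 s) (trans1 t) /\ extends m (trans2 s) (trans2 t).

Definition complete_wrt_dependence (rho1 rho2 : rule)
    (S : set (tpair rho1 rho2)) : Prop :=
  forall t : tpair rho1 rho2, parallel_dependent t ->
    exists2 s, S s & embeds s t.

(* Main.v *)
(* Rule 1 has empty left-hand side, changes nothing, and requires that there  *)
(* is a vertex and that every vertex has an edge to another vertex; rule 2    *)
(* creates an isolated vertex, hence always invalidates this condition. On    *)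
(* the infinite ray 0 -> 1 -> 2 -> ... the two are parallel dependent. A pair *)
(* embedded into it has a source K which itself satisfies the condition and   *)
(* maps to the ray; the vertices of K of maximal image would have no outgoing *)
(* edge, so K is infinite.                                                    *)
Require Import Defs.
From mathcomp Require Import all_boot.
From mathcomp Require Import boolp classical_sets functions cardinality.

Set Implicit Arguments.
Unset Strict Implicit.
Unset Printing Implicit Defensive.

(** The obstruction is that the condition of [check_rule] forces an infinite source. By
    [ray_dependent] the two rules are parallel dependent on the infinite ray. If a pair embeds into
    this one, its own check transformation satisfies [successor_ac], so its source K is nonempty and
    every vertex has an outgoing edge. The extension morphism sends each edge of K to a step from n
    to n+1, so by [successor_hom_nat_infinite] K is infinite, whereas the pairs of [S] have finite
    sources. *)

Lemma hom_eq (G H : graph) (f g : hom G H) :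
  vmap f =1 vmap g -> emap f =1 emap g -> f = g.
Proof.
case: f g => [vf ef sf tf] [vg eg sg tg] /= /funext eqv /funext eqe.
by subst vg eg; congr Hom; apply: Prop_irrelevance.
Qed.

Definition hom_id (G : graph) : hom G G :=
  @Hom G G id id (fun=> erefl) (fun=> erefl).

Lemma hom_id_mono (G : graph) : mono (hom_id G).
Proof. by split=> ? ?. Qed.

Lemma hom_compf1 (G H : graph) (f : hom G H) : f \oh hom_id G = f.
Proof. exact: hom_eq. Qed.

Lemma hom_comp1f (G H : graph) (f : hom G H) : hom_id H \oh f = f.
Proof. exact: hom_eq. Qed.

(** Provides the double pushout squares on the sides where a rule changes nothing. *)
Lemma pushout_id (A B : graph) (f : hom A B) :
  is_pushout (hom_id A) f f (hom_id B).
Proof.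
split=> [|X h k]; first by rewrite hom_compf1 hom_comp1f.
rewrite hom_compf1 => eq_hk; exists k; split=> [|u [_ <-]].
  by split; [rewrite eq_hk|rewrite hom_compf1].
by rewrite hom_compf1.
Qed.

Definition empty_graph : graph := @Graph void void id id.

Definition point_graph : graph :=
  @Graph unit void (fun=> tt) (fun=> tt).

Definition arrow_graph : graph :=
  @Graph bool unit (fun=> false) (fun=> true).

Definition empty_hom (G : graph) : hom empty_graph G :=
  @Hom empty_graph G (of_void _) (of_void _)
    (fun e => match e with end) (fun e => match e with end).

Definition point_hom (G : graph) (v : vertex G) : hom point_graph G :=
  @Hom point_graph G (fun=> v) (of_void _)
    (fun e => match e with end) (fun e => match e with end).

Definition arrow_hom (G : graph) (e : edge G) : hom arrow_graph G :=
  @Hom arrow_graph G (fun b => if b then tgt e else src e) (fun=> e)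
    (fun=> erefl) (fun=> erefl).

Lemma empty_hom_eq (G : graph) (f g : hom empty_graph G) : f = g.
Proof. by apply: hom_eq => -[]. Qed.

Lemma empty_hom_mono (G : graph) : mono (empty_hom G).
Proof. by split=> -[]. Qed.

Lemma point_hom_mono (G : graph) (v : vertex G) : mono (point_hom v).
Proof. by split=> [[] []|[]]. Qed.

Lemma arrow_hom_mono (G : graph) (e : edge G) :
  tgt e <> src e -> mono (arrow_hom e).
Proof. by move=> ne; split=> [[] []|[] []] //= /esym. Qed.

Definition coprod (A B : graph) : graph :=
  @Graph (vertex A + vertex B) (edge A + edge B)
    (fun e => match e with inl e => inl (src e) | inr e => inr (src e) end)
    (fun e => match e with inl e => inl (tgt e) | inr e => inr (tgt e) end).

Definition coprod_inl (A B : graph) : hom A (coprod A B) :=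
  @Hom A (coprod A B) inl inl (fun=> erefl) (fun=> erefl).

Definition coprod_inr (A B : graph) : hom B (coprod A B) :=
  @Hom B (coprod A B) inr inr (fun=> erefl) (fun=> erefl).

(** The empty graph is initial, so gluing along it is disjoint union; this lets [create_rule] add an
    isolated vertex. *)
Lemma pushout_coprod (A B : graph) (f : hom empty_graph A)
    (g : hom empty_graph B) :
  is_pushout f g (coprod_inl A B) (coprod_inr A B).
Proof.
split=> [|X h k _]; first exact: empty_hom_eq.
pose vu (x : vertex (coprod A B)) :=
  match x with inl v => vmap h v | inr v => vmap k v end.
pose eu (x : edge (coprod A B)) :=
  match x with inl e => emap h e | inr e => emap k e end.
have su e : src (eu e) = vu (src e) by case: e => e; apply: hom_src.
have tu e : tgt (eu e) = vu (tgt e) by case: e => e; apply: hom_tgt.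
exists (Hom su tu); split; first by split; apply: hom_eq.
move=> u [uh uk]; apply: hom_eq => -[] x /=.
- by rewrite -uh.
- by rewrite -uk.
- by rewrite -uh.
- by rewrite -uk.
Qed.

Lemma finite_empty_graph : finite_graph empty_graph.
Proof. by split; apply: (@finite_finset void). Qed.

Lemma finite_point_graph : finite_graph point_graph.
Proof.
by split; [apply: (@finite_finset unit) | apply: (@finite_finset void)].
Qed.

Lemma finite_arrow_graph : finite_graph arrow_graph.
Proof.
by split; [apply: (@finite_finset bool) | apply: (@finite_finset unit)].
Qed.

(** The universal quantifier is written as not-exists-not. Satisfaction asks for injective
    morphisms, so the arrow found at a vertex is never a loop. *)
Definition successor_ac : ac empty_graph :=
  ac_and [:: ac_ex (empty_hom point_graph) (ac_and [::]);
    ac_not (ac_ex (empty_hom point_graph)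
      (ac_not (ac_ex (@point_hom arrow_graph false) (ac_and [::]))))].

Lemma successor_acP (G : graph) (p : hom empty_graph G) :
  sat successor_ac p <->
  (exists _ : vertex G, True) /\
  forall v : vertex G, exists2 e : edge G, src e = v & tgt e <> v.
Proof.
split=> [[[q _] [noq _]]|[[v _] succ]].
  split=> [|v]; first by exists (vmap q tt).
  apply: contrapT => nov; apply: noq; exists (point_hom v).
  split; [exact: point_hom_mono|exact: empty_hom_eq|].
  move=> -[r [[r_inj _] rv _]]; apply: nov.
  have rs : vmap r false = v :=
    congr1 (fun f : hom point_graph G => vmap f tt) rv.
  exists (emap r tt); first by rewrite hom_src.
  rewrite hom_tgt => rt.
  by have := r_inj true false (etrans rt (esym rs)).
split; first exists (point_hom v).
  by split; [exact: point_hom_mono|exact: empty_hom_eq|].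
split=> // -[q [_ _ noq]]; apply: noq.
have [e se te] := succ (vmap q tt).
exists (arrow_hom e); split=> //; first by apply: arrow_hom_mono; rewrite se.
by apply: hom_eq => -[].
Qed.

(** Following outgoing edges makes [f] grow without bound, which a finite vertex set cannot allow.
    [f] need not be injective. *)
Lemma successor_hom_nat_infinite (G : graph) (f : vertex G -> nat) :
  (forall e : edge G, f (src e) < f (tgt e)) ->
  (exists _ : vertex G, True) ->
  (forall v : vertex G, exists e : edge G, src e = v) ->
  infinite_set [set: vertex G].
Proof.
move=> f_lt [v0 _] succ finG.
have : finite_set (range f) by exact: finite_image.
move=> /finite_seqP[s fs].
have f_le v : f v <= \max_(i <- s) i.
  have : range f (f v) by exists v.
  rewrite fs => /= fvs; exact: (@leq_bigmax_seq _ s predT id).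
(* Each outgoing edge raises [f] by at least one, so walking from [v0] reaches every height. *)
have f_ge n : exists v, n <= f v.
  elim: n => [|n [v nv]]; first by exists v0.
  have [e se] := succ v; exists (tgt e).
  by apply: leq_ltn_trans (f_lt e); rewrite se.
by have [v /leq_trans/(_ (f_le v))] := f_ge (\max_(i <- s) i).+1; rewrite ltnn.
Qed.

Definition check_rule : rule :=
  @Rule (Span (hom_id_mono empty_graph) (hom_id_mono empty_graph))
    successor_ac.

Definition create_rule : rule :=
  @Rule (Span (hom_id_mono empty_graph) (empty_hom_mono point_graph))
    (ac_and [::]).

Lemma finite_check_rule : finite_rule check_rule.
Proof.
have fe := finite_empty_graph.
have fp := finite_point_graph.
have fa := finite_arrow_graph.
by split=> //=; do !split.
Qed.

Lemma finite_create_rule : finite_rule create_rule.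
Proof.
have fe := finite_empty_graph.
by split=> //=; exact: finite_point_graph.
Qed.

Definition ray : graph := @Graph nat nat id S.

Lemma ray_successor : sat successor_ac (empty_hom ray).
Proof.
apply/successor_acP; split=> [|n]; first by exists 0.
by exists n => //= /esym/n_Sn.
Qed.

Definition ray_check : dtrans check_rule ray ray :=
  @DTrans check_rule _ _ _ _ _ _ _ _ (pushout_id (empty_hom ray))
    (pushout_id (empty_hom ray)) ray_successor.

Definition ray_create : dtrans create_rule ray (coprod point_graph ray) :=
  @DTrans create_rule _ _ _ _ _ _ _ _ (pushout_id (empty_hom ray))
    (pushout_coprod (empty_hom point_graph) (empty_hom ray)) I.

Lemma ray_dependent : parallel_dependent (TPair ray_check ray_create).
Proof.
move=> [[d [_ /successor_acP[_ succ]]] _].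
(* The created vertex [inl tt] has no outgoing edge: the point has no edges, and edges of the ray
   start in the [inr] part. *)
by have [[]] := succ (inl tt).
Qed.

Theorem theorem4 :
  exists rho1 rho2 : rule,
    finite_rule rho1 /\ finite_rule rho2 /\
    forall S : set (tpair rho1 rho2),
      finite_set S ->
      (forall s : tpair rho1 rho2, S s -> finite_tpair s) ->
      ~ complete_wrt_dependence S.
Proof.
exists check_rule, create_rule.
split; [exact: finite_check_rule|split; first exact: finite_create_rule].
move=> S _ finS compl.
have [s /finS[[finK _] _ _] [m _]] := compl _ ray_dependent.
have /successor_acP[K0 succ] := match_sat (trans1 s).
(* Vertices of the ray are natural numbers, so the vertex part of [m] is itself the height
   function. *)
apply: (@successor_hom_nat_infinite _ (vmap m)) finK => // [e|v].
  by rewrite -hom_src -hom_tgt /=.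
by have [e se _] := succ v; exists e.
Qed.
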